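(* For any $c>1$ the norms $\|\cdot\|_{\mathcal L}$ and $|||\cdot|||_c$ on the space of complex polynomials are not equivalent. More generally, $\|\cdot\|_{\mathcal L}$ is not equivalent to any operator algebra norm on the algebra of complex polynomials.
   Context: Polynomials are $P(z)=\sum_{n\ge0} a_nz^n$ with finitely many nonzero coefficients $a_n\in\mathbb C$; they form an algebra under the usual product. For $c>1$, $$|||P|||_c=\sup\Big\{\Big\|\sum_n a_nT^n\Big\|\Big\},$$ where the supremum runs over all operators $T\in B(\ell_2)$ with $\sup_{n\ge1}\|T^n\|\le c$. Let $\ell_1\overset{\vee}{\otimes}\ell_1$ be the injective (Banach space) tensor product of $\ell_1=\ell_1(\mathbb N)$ with itself, with canonical basis $(e_i)_{i\ge 0}$ of $\ell_1$. Define $$\|P\|_{\mathcal L}=\inf\big\{\|A\|_{\ell_1\overset{\vee}{\otimes}\ell_1}\big\},$$ where the infimum runs over all elements $A=\sum A_{ij}\,e_i\otimes e_j$ of $\ell_1\overset{\vee}{\otimes}\ell_1$ such that $a_n=\sum_{i+j=n}A_{ij}$ for all $n\ge 0$. A norm on the algebra of polynomials is an operator algebra norm if it is a submultiplicative norm such that the resulting Banach algebra (the completion) can be isometrically embedded, as an algebra, into the algebra $B(H)$ of all bounded operators on some Hilbert space $H$. *)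

(* Defs.v *)
From HB Require Import structures.
From mathcomp Require Import all_boot all_order all_algebra.
From mathcomp Require Import complex.
From mathcomp Require Import all_classical all_reals all_analysis.

Set Implicit Arguments.
Unset Strict Implicit.
Unset Printing Implicit Defensive.

Import Order.TTheory GRing.Theory Num.Theory.
Import numFieldNormedType.Exports.

Local Open Scope classical_set_scope.
Local Open Scope ring_scope.

Notation normc := (@ComplexField.Normc.normc _).

Lemma normc_ge0 (R : rcfType) (z : R[i]) : 0 <= normc z.
Proof. by have := normr_ge0 z; rewrite normc_def lecR; case: z. Qed.

(* The library norm of a normed space over R[i] takes values in R[i], where it
   is real and nonnegative; [rnorm] is the same number as an element of R. *)
Definition rnorm (R : realType) (V : normedModType R[i]) (x : V) : R :=
  complex.Re `|x|.

(** * The complex sequence spaces l_p *)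

Section lp_pred.
Context {R : realType}.
Implicit Types (p : R) (x y : nat -> R[i]).

(* The L^p norm for the counting measure, that is
   (\sum_n |x_n|^p)^(1/p), possibly +oo. *)
Definition lpnorm p x : \bar R :=
  'N[@counting nat R]_p%:E[EFin \o (normc \o x)]%E.

Definition lp_pred p (p1 : 1 <= p) : {pred nat -> R[i]} :=
  fun x => (lpnorm p x < +oo)%E.

Let normc_pos (z : R[i]) : 0 <= normc z. Proof. exact: normc_ge0. Qed.

Let le_poweR (r : R) (u v : \bar R) :
  0 <= r -> (0 <= u -> u <= v -> u `^ r <= v `^ r)%E.
Proof.
move=> r0 u0 uv; apply: gt0_ler_poweR => //; rewrite in_itv/= leey andbT//.
exact: le_trans uv.
Qed.

Lemma lpnormE p x : 1 <= p ->
  lpnorm p x = ((\sum_(k <oo) (normc (x k) `^ p)%:E) `^ p^-1)%E.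
Proof.
move=> p1; rewrite /lpnorm Lnorm_counting ?(lt_le_trans ltr01)//.
congr (_ `^ _)%E; apply: eq_eseriesr => k _.
have -> : (`|(EFin \o (normc \o x)) k| = (normc (x k))%:E)%E.
  by rewrite gee0_abs /= ?lee_fin.
by rewrite poweR_EFin.
Qed.

Lemma lpnorm_ge p x n : 1 <= p -> ((normc (x n))%:E <= lpnorm p x)%E.
Proof.
move=> p1; have p0 : 0 < p by apply: lt_le_trans p1.
rewrite lpnormE//.
have -> : (normc (x n))%:E = ((normc (x n) `^ p)%:E `^ p^-1)%E.
  by rewrite poweR_EFin -powRrM divff ?gt_eqF// powRr1.
have sge0 : (0 <= \sum_(k <oo) (normc (x k) `^ p)%:E)%E.
  by apply: nneseries_ge0 => k _ _; rewrite lee_fin powR_ge0.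
apply: le_poweR; rewrite ?invr_ge0 ?(ltW p0) ?lee_fin ?powR_ge0//.
rewrite (@nneseriesD1 _ _ n)//; last by move=> k _; rewrite lee_fin powR_ge0.
by rewrite leeDl// nneseries_ge0// => k _ _; rewrite lee_fin powR_ge0.
Qed.

Lemma lpnormD p x y : 1 <= p ->
  (lpnorm p (x + y)%R <= lpnorm p x + lpnorm p y)%E.
Proof.
move=> p1; have p0 : 0 < p by apply: lt_le_trans p1.
apply: le_trans; last first.
  by apply: (@eminkowski _ nat R counting (normc \o x) (normc \o y)).
rewrite /lpnorm !Lnorm_counting//.
have sge0 (u : nat -> \bar R) : (0 <= \sum_(k <oo) (`|u k| `^ p))%E.
  by apply: nneseries_ge0 => k _ _; rewrite poweR_ge0.
apply: le_poweR; rewrite ?invr_ge0 ?(ltW p0)//.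
apply: lee_nneseries => k _; first by rewrite poweR_ge0.
apply: le_poweR; rewrite ?(ltW p0) ?abse_ge0// !gee0_abs/= ?lee_fin ?addr_ge0//.
exact: le_normcD.
Qed.

Lemma lpnormZ p (a : R[i]) x : 1 <= p ->
  lpnorm p (a *: x) = ((normc a)%:E * lpnorm p x)%E.
Proof.
move=> p1; have p0 : 0 < p by apply: lt_le_trans p1.
rewrite !lpnormE//.
have sge0 : (0 <= \sum_(k <oo) (normc (x k) `^ p)%:E)%E.
  by apply: nneseries_ge0 => k _ _; rewrite lee_fin powR_ge0.
under eq_eseriesr => k _.
  rewrite (_ : normc ((a *: x) k) = normc a * normc (x k)); last first.
    exact: ComplexField.Normc.normcM.
  rewrite powRM// EFinM.
over.
rewrite nneseriesZl; last by move=> k _; rewrite lee_fin powR_ge0.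
rewrite poweRM ?lee_fin ?powR_ge0//.
by rewrite poweR_EFin -powRrM divff ?gt_eqF// powRr1.
Qed.

Lemma lp_submod_closed p (p1 : 1 <= p) : submod_closed (lp_pred p1).
Proof.
split.
  rewrite unfold_in /lp_pred.
  rewrite -[0](scale0r (0 : nat -> R[i])) lpnormZ//.
  by rewrite ComplexField.Normc.normc0 mul0e ltry.
move=> a x y; rewrite !unfold_in /lp_pred => xp yp.
apply: (le_lt_trans (lpnormD _ _ p1)); rewrite lpnormZ//.
by rewrite lte_add_pinfty// lte_mul_pinfty// lee_fin.
Qed.

HB.instance Definition _ p (p1 : 1 <= p) :=
  GRing.isSubmodClosed.Build _ _ (lp_pred p1) (lp_submod_closed p1).

End lp_pred.

Record lp (R : realType) (p : R) (p1 : 1 <= p) := Lp {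
  lp_val :> nat -> R[i];
  _ : lp_val \in lp_pred p1 }.

HB.instance Definition _ (R : realType) (p : R) (p1 : 1 <= p) :=
  [isSub for @lp_val R p p1].
HB.instance Definition _ (R : realType) (p : R) (p1 : 1 <= p) :=
  [Choice of lp p1 by <:].
HB.instance Definition _ (R : realType) (p : R) (p1 : 1 <= p) :=
  [SubChoice_isSubLmodule of lp p1 by <:].

Section lp_norm.
Context {R : realType} {p : R} {p1 : 1 <= p}.
Implicit Types x y : lp p1.

Definition lp_norm x : R[i] := (fine (lpnorm p x))%:C%C.

Let lpnorm_fin x : lpnorm p x \is a fin_num.
Proof.
rewrite ge0_fin_numE; first exact: valP x.
exact: Lnorm_ge0.
Qed.

Lemma lp_normD x y : lp_norm (x + y) <= lp_norm x + lp_norm y.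
Proof.
rewrite /lp_norm -rmorphD/= lecR -fineD// fine_le ?fin_numD ?lpnorm_fin//.
  exact: lpnorm_fin (x + y).
exact: (lpnormD (lp_val x) (lp_val y) p1).
Qed.

Lemma lp_normZ (a : R[i]) x : lp_norm (a *: x) = `|a| * lp_norm x.
Proof.
rewrite /lp_norm (_ : `|a| = (normc a)%:C%C); last by case: a.
rewrite -rmorphM/=; congr (_%:C%C); apply: EFin_inj.
rewrite EFinM !fineK ?(lpnorm_fin x) ?(lpnorm_fin (a *: x))//.
exact: (lpnormZ a (lp_val x) p1).
Qed.

Lemma lp_norm_eq0 x : lp_norm x = 0 -> x = 0.
Proof.
move=> [x0]; apply/val_inj/funext => n.
apply: ComplexField.Normc.eq0_normc; apply/le_anti/andP; split.
  rewrite -lee_fin (le_trans (lpnorm_ge _ _ p1))//.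
  by rewrite -(fineK (lpnorm_fin x)) x0.
exact: normc_ge0.
Qed.

HB.instance Definition _ :=
  Lmodule_isNormed.Build R[i] (lp p1) lp_normD lp_normZ lp_norm_eq0.

End lp_norm.

Definition ell1 (R : realType) := lp (lexx (1 : R)).
Definition ell2 (R : realType) := lp (ler1n R 2 : (1 : R) <= 2).

(** * Bounded operators *)

Record bounded_op (R : realType) (V W : normedModType R[i]) := BoundedOp {
  bop_fun :> {linear V -> W};
  bop_continuous : continuous bop_fun }.

Definition opnorm (R : realType) (V W : normedModType R[i]) (T : V -> W)
    : \bar R :=
  ereal_sup [set (rnorm (T x))%:E | x in [set x : V | rnorm x <= 1]].

Definition dual (R : realType) (X : normedModType R[i]) :=
  bounded_op X (R[i]^o).

(** * The injective tensor product *)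

Section injective_tensor.
Context {R : realType} {X Y : normedModType R[i]}.
Implicit Types B : dual X -> dual Y -> R[i].

(* The finite tensor \sum_k x_k (x) y_k, as a function on the product of the
   duals. *)
Definition finite_tensor (u : seq (X * Y)) : dual X -> dual Y -> R[i] :=
  fun phi psi => \sum_(xy <- u) phi xy.1 * psi xy.2.

Definition injective_norm B : \bar R :=
  ereal_sup [set t | exists (phi : dual X) (psi : dual Y),
    [/\ (opnorm phi <= 1)%E, (opnorm psi <= 1)%E &
        t = (normc (B phi psi))%:E]].

(* The completion of the algebraic tensor product for the injective norm,
   realized as its closure in the space of functions on the product of the dual
   unit balls with the uniform norm (values off the balls are irrelevant). *)
Definition injective_tensor : set (dual X -> dual Y -> R[i]) :=
  [set B | forall e : R, 0 < e -> exists u : seq (X * Y),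
    (injective_norm (fun phi psi => B phi psi - finite_tensor u phi psi)%R
      <= e%:E)%E].

End injective_tensor.

(** * The two norms on complex polynomials *)

Section coordinates.
Context {R : realType} (n : nat).

Definition ell1_coord_fun (x : ell1 R) : R[i]^o := lp_val x n.

Let coord_linear : linear ell1_coord_fun.
Proof. by []. Qed.

HB.instance Definition _ := GRing.isLinear.Build R[i] (ell1 R) R[i]^o _
  ell1_coord_fun coord_linear.

Let coord_continuous : continuous ell1_coord_fun.
Proof.
apply: bounded_linear_continuous; apply/linear_boundedP.
near=> r => x; rewrite (_ : `|ell1_coord_fun x| = (normc (lp_val x n))%:C%C).
  apply: (@le_trans _ _ `|x|); last by rewrite ler_peMl//; near: r.
  rewrite lecR -lee_fin fineK ?lpnorm_ge//.
  by rewrite ge0_fin_numE; [exact: valP x | exact: Lnorm_ge0].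
by rewrite /ell1_coord_fun; case: (lp_val x n).
Unshelve. all: by end_near. Qed.

(* The functional e_n^* on ell_1, mapping x to x_n. *)
Definition ell1_coord : dual (ell1 R) :=
  @BoundedOp R (ell1 R) R[i]^o ell1_coord_fun coord_continuous.

End coordinates.

(* The coefficient A_ij of an element B of the tensor product of ell_1 with
   itself is the value of B at (e_i^*, e_j^* ).  The norms below take values in
   the extended reals, so that suprema and infima have no default value. *)
Definition Lnorm_poly (R : realType) (P : {poly R[i]}) : \bar R :=
  ereal_inf [set injective_norm B | B in
    [set B : dual (ell1 R) -> dual (ell1 R) -> R[i] |
      injective_tensor B /\
      forall n, P`_n = \sum_(i < n.+1) B (ell1_coord i) (ell1_coord (n - i)%N)]].

Definition poly_op (R : realType) (V : normedModType R[i]) (P : {poly R[i]})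
    (T : V -> V) : V -> V :=
  fun x => \sum_(n < size P) P`_n *: iter n T x.

Definition power_norm (R : realType) (c : R) (P : {poly R[i]}) : \bar R :=
  ereal_sup [set opnorm (poly_op P T) | T in
    [set T : bounded_op (ell2 R) (ell2 R) |
      (ereal_sup [set opnorm (iter n T) | n in [set n | (1 <= n)%N]]
        <= c%:E)%E]].

Definition equivalent_norms (R : realType) (N M : {poly R[i]} -> \bar R) :=
  exists a b : R, [/\ 0 < a, 0 < b &
    forall P, (a%:E * N P <= M P <= b%:E * N P)%E].

(** * Operator algebra norms *)

(* A unit is not required: in a completion of the polynomials the image of 1 is
   one. *)
Record banach_algebra (R : realType) := BanachAlgebra {
  ba_sort :> completeNormedModType R[i];
  ba_mul : {bilinear ba_sort -> ba_sort -> ba_sort};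
  ba_mulA : associative ba_mul;
  ba_norm_mul : forall a b, `|ba_mul a b| <= `|a| * `|b| }.

Arguments ba_mul {R _}.

Record hilbert (R : realType) := Hilbert {
  hilbert_sort :> completeNormedModType R[i];
  hdot : {dot hilbert_sort for Num.conj};
  hdotE : forall x : hilbert_sort, `|x| ^+ 2 = hdot x x }.

Arguments hdot {R _}.

Section operator_algebra_norms.
Context {R : realType}.
Implicit Types N : {poly R[i]} -> R.

Definition submultiplicative_norm N : Prop :=
  [/\ forall P Q, N (P + Q) <= N P + N Q,
      forall (a : R[i]) P, N (a *: P) = normc a * N P,
      forall P, N P = 0 -> P = 0 &
      forall P Q, N (P * Q) <= N P * N Q].

(* A, with j, is the completion of the normed algebra of polynomials for N. *)
Definition is_completion N (A : banach_algebra R)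
    (j : {linear {poly R[i]} -> A}) : Prop :=
  [/\ forall P Q, j (P * Q) = ba_mul (j P) (j Q),
      forall P, rnorm (j P) = N P &
      dense (range j)].

(* The embedding need not preserve the unit. *)
Definition isometric_embedding (A : banach_algebra R) (H : hilbert R)
    (f : A -> bounded_op H H) : Prop :=
  [/\ forall (k : R[i]) (a b : A) (x : H),
        f (k *: a + b) x = k *: f a x + f b x,
      forall (a b : A) (x : H), f (ba_mul a b) x = f a (f b x) &
      forall a : A, opnorm (f a) = (rnorm a)%:E].

Definition operator_algebra_norm N : Prop :=
  submultiplicative_norm N /\
  exists (A : banach_algebra R) (j : {linear {poly R[i]} -> A}),
    is_completion N j /\
    exists (H : hilbert R) (f : A -> bounded_op H H), isometric_embedding f.

End operator_algebra_norms.

(* Main.v *)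
From HB Require Import structures.
Require Import Defs.
From mathcomp Require Import all_boot all_order all_algebra.
From mathcomp Require Import cyclic separable cyclotomic.
From mathcomp Require Import zify ring.
From mathcomp Require Import complex.
From mathcomp Require Import all_classical all_reals all_analysis.

(** Write L for the norm [Lnorm_poly].  Fix an odd k, put n = k^2, let w be a
    primitive n-th root of unity and t_j = n 8^(j+1).  The polynomials
      P = sum_(j < n) z^(t_j) X_j^2,   X_j = sum_(i < n) w^(-ij) z^i,
    separate L from [power_norm] and from every operator algebra norm: L(P) is at
    least n^(5/2) / 9, while P has norm at most c^3 n^2 for [power_norm c], c > 1,
    and for any operator algebra norm in which the powers of z are bounded by c.
    Such a c exists if the norm is equivalent to L, because L(z^m) <= 1
    ([Lnorm_monomial]).

    Upper bound ([test_poly_upper]).  Let W_m be the operators on a Hilbert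
    space that represent z^m, of norm at most c.  Then P acts as
    sum_i W_i (sum_j w^(-ij) v_j) with v_j = W_(t_j) X_j(W) x.  The
    Cauchy-Schwarz inequality over i, followed by the Plancherel identity, once
    in j and once inside X_j(W) x = sum_l w^(-jl) W_l x, gives the bound
    c^3 n^2 |x|.  The Hilbert space structure is used only through Plancherel.

    Lower bound ([test_poly_lower]).  By duality it is enough to have a function
    phi on the natural numbers which pairs with P to at least n^4 and whose
    Hankel matrix phi(a + b) satisfies
      |sum_(a, b) phi(a + b) B_ab| <= 3n (2k + 1) |B|
    for every B, where |B| is the norm of B in the injective tensor product
    ([test_fun_pairing], [test_fun_bound]).  Take
      phi(m) = sum_j w^(jm) chi(m - t_j)
    with chi the autocorrelation of the indicator function of [0, 3n).  Being an
    autocorrelation, chi is a combination of characters with nonnegative weights,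
    whose sum is chi(0) = 3n.  Since the t_j grow geometrically,
    chi(a + b - t_j) <> 0 forces a or b to be of the order of t_j, and then that
    coordinate alone determines j.  It remains to bound the matrices
    sum_j x_j(a) w^(jb) in which, for each a, at most one x_j(a) is nonzero, and
    these only cost the factor k = sqrt n: the orthogonality relations of the
    n-th roots of unity, modified by the phases w^(j^2), write them as averages of
    products f(a) g(b) with |f| <= 1 and g a Gauss sum, of modulus exactly sqrt n
    ([mult_bound_fourier], [gauss_sum_norm]).

    An equivalence of norms would thus force k <= 9 c^3 / a, with fixed a > 0 and
    c, for all odd k ([no_test_poly_bound]). *)

Set Implicit Arguments.
Unset Strict Implicit.
Unset Printing Implicit Defensive.

Import Order.TTheory GRing.Theory Num.Theory.
Import numFieldNormedType.Exports.

Local Open Scope classical_set_scope.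
Local Open Scope ring_scope.

(** * Roots of unity and Gauss sums *)

Section Roots.
Variable C : numClosedFieldType.

Lemma primitive_root_exists n : (0 < n)%N -> exists w : C, n.-primitive_root w.
Proof.
move=> n_gt0; pose p : {poly C} := 'X^n - 1.
have [r Dp] := closed_field_poly_normal p.
rewrite (monicP _) ?monicXnsubC // scale1r in Dp.
have rn1 : all n.-unity_root r by apply/allP=> z; rewrite -root_prod_XsubC -Dp.
have sz_r : (n < (size r).+1)%N.
  by rewrite -(size_prod_XsubC r id) -Dp size_XnsubC.
have [|w] := hasP (has_prim_root n_gt0 rn1 _ sz_r); last by exists w.
by rewrite -separable_prod_XsubC -Dp separable_Xn_sub_1 // pnatr_eq0 -lt0n.
Qed.

Lemma sum_shift_periodic (V : zmodType) n l (F : nat -> V) :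
  (forall j, F (j + n)%N = F j) -> \sum_(j < n) F (l + j)%N = \sum_(j < n) F j.
Proof.
move=> perF; elim: l => [//|l IHl]; rewrite -IHl.
apply: (addrI (F l)); transitivity (\sum_(j < n.+1) F (l + j)%N).
  rewrite big_ord_recl addn0; congr (_ + _).
  by apply: eq_bigr => j _; rewrite addSnnS.
by rewrite big_ord_recr /= addrC perF.
Qed.

Section Fixed.
Variables (n : nat) (w : C).
Hypothesis prim_w : n.-primitive_root w.

Let n_gt0 : (0 < n)%N := prim_order_gt0 prim_w.

Lemma norm_primitive_root : `|w| = 1.
Proof.
apply/eqP; rewrite -(@pexpr_eq1 _ _ n) //.
by rewrite -normrX prim_expr_order // normr1.
Qed.

Lemma norm_primitive_rootX k : `|w ^+ k| = 1.
Proof. by rewrite normrX norm_primitive_root expr1n. Qed.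

Lemma norm_primitive_rootV k : `|w ^- k| = 1.
Proof. by rewrite normfV norm_primitive_rootX invr1. Qed.

Lemma primitive_root_neq0 : w != 0.
Proof. by rewrite -normr_gt0 norm_primitive_root ltr01. Qed.

Lemma conj_primitive_rootX k : (w ^+ k)^* = w ^- k.
Proof.
by rewrite invC_norm norm_primitive_rootX expr1n invr1 mul1r.
Qed.

Lemma sum_primitive_root j l :
  \sum_(s < n) w ^+ (j * s) * w ^- (l * s) =
  if j == l %[mod n] then n%:R else 0.
Proof.
pose x := w ^+ j / w ^+ l.
have -> : \sum_(s < n) w ^+ (j * s) * w ^- (l * s) = \sum_(s < n) x ^+ s.
  by apply: eq_bigr => s _; rewrite /x expr_div_n !exprM.
rewrite -(eq_prim_root_expr prim_w).
rewrite -(inj_eq (mulIf (invr_neq0 (expf_neq0 l primitive_root_neq0)))).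
rewrite divff ?expf_neq0 ?primitive_root_neq0 // -/x.
case: eqP => [-> | /eqP x1].
  by under eq_bigr do rewrite expr1n; rewrite sumr_const card_ord.
apply: (mulfI (x := x - 1)); first by rewrite subr_eq0.
rewrite -subrX1 mulr0 /x expr_div_n -!exprM ![(_ * n)%N]mulnC !exprM.
by rewrite (prim_expr_order prim_w) !expr1n invr1 mulr1 subrr.
Qed.

(** A quadratic Gauss sum of odd order n has modulus sqrt n, whatever the linear
    term in the exponent. *)
Lemma gauss_sum_norm c : odd n ->
  `|\sum_(j < n) w ^+ (j ^ 2 + j * c)| ^+ 2 = n%:R.
Proof.
move=> odd_n; rewrite normCK rmorph_sum /= mulr_sumr.
pose F l j := w ^+ (j ^ 2 + j * c) * w ^- (l ^ 2 + l * c).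
transitivity (\sum_(l < n) \sum_(d < n) F l (l + d)%N).
  (* the substitution j = l + d makes the exponent linear in l *)
  apply: eq_bigr => l _; rewrite (@sum_shift_periodic _ _ _ (F l)).
    rewrite mulr_suml; apply: eq_bigr => j _.
    by rewrite /F conj_primitive_rootX.
  move=> j; rewrite /F.
  have -> : ((j + n) ^ 2 + (j + n) * c =
             j ^ 2 + j * c + n * (2 * j + n + c))%N by lia.
  rewrite [w ^+ (_ + n * _)]exprD [w ^+ (n * _)]exprM.
  by rewrite (prim_expr_order prim_w) expr1n mulr1.
rewrite exchange_big /=.
transitivity (\sum_(d < n) w ^+ (d ^ 2 + d * c) *
   \sum_(l < n) w ^+ (2 * d * l) * w ^- (0 * l)).
  apply: eq_bigr => d _; rewrite mulr_sumr; apply: eq_bigr => l _.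
  rewrite /F mul0n expr0 invr1 mulr1.
  have -> : ((l + d) ^ 2 + (l + d) * c =
             d ^ 2 + d * c + 2 * d * l + (l ^ 2 + l * c))%N by lia.
  by rewrite exprD mulfK ?expf_neq0 ?primitive_root_neq0 // exprD.
under eq_bigr do rewrite sum_primitive_root mod0n -/(dvdn _ _).
rewrite (bigD1 (Ordinal n_gt0)) //= big1 => [|d d0].
  by rewrite muln0 dvdn0 exp0n // expr0 mul1r addr0.
rewrite ifF ?mulr0 //; apply/negbTE; rewrite Gauss_dvdr ?coprimen2 //.
by rewrite gtnNdvd // lt0n -[0%N]/(val (Ordinal n_gt0)) val_eqE.
Qed.

End Fixed.
End Roots.

(** * Multipliers of bilinear forms *)

Section MultBound.
Variable C : numClosedFieldType.
Variable K : nat.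
Implicit Types (M B : nat -> nat -> C) (f g : nat -> C).

(** The K x K matrix B has norm at most b as a bilinear form on l_oo.  For the
    coefficients of an element of the injective tensor square of l_1, this holds
    for all K when b is at least the injective norm. *)
Definition form_bound B (b : C) : Prop :=
  forall f g, (forall i, `|f i| <= 1) -> (forall i, `|g i| <= 1) ->
    `|\sum_(i < K) \sum_(j < K) f i * g j * B i j| <= b.

(** M has norm at most c as a functional on K x K matrices with the norm of
    [form_bound]. *)
Definition mult_bound M (c : C) : Prop :=
  forall B b, form_bound B b ->
    `|\sum_(i < K) \sum_(j < K) M i j * B i j| <= c * b.

Lemma eq_mult_bound M M' c :
  (forall i j, (i < K)%N -> (j < K)%N -> M i j = M' i j) ->
  mult_bound M c -> mult_bound M' c.
Proof.
move=> eqM bM B b bB; have := bM _ _ bB; congr (`|_| <= _).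
by apply: eq_bigr => i _; apply: eq_bigr => j _; rewrite eqM.
Qed.

Lemma mult_bound_tensor f g (s t : C) : 0 < s -> 0 < t ->
  (forall i, `|f i| <= s) -> (forall i, `|g i| <= t) ->
  mult_bound (fun i j => f i * g j) (s * t).
Proof.
move=> s0 t0 fs gt B b bB.
have st0 : 0 < s * t by rewrite mulr_gt0.
have -> : \sum_(i < K) \sum_(j < K) f i * g j * B i j =
   s * t * \sum_(i < K) \sum_(j < K) f i / s * (g j / t) * B i j.
  rewrite mulr_sumr; apply: eq_bigr => i _.
  rewrite mulr_sumr; apply: eq_bigr => j _.
  by field; rewrite !gt_eqF.
rewrite normrM gtr0_norm // ler_pM2l //.
apply: (bB (fun i => f i / s) (fun j => g j / t)) => i.
  by rewrite normrM normfV (gtr0_norm s0) ler_pdivrMr // mul1r.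
by rewrite normrM normfV (gtr0_norm t0) ler_pdivrMr // mul1r.
Qed.

Lemma mult_boundZ z M c : mult_bound M c ->
  mult_bound (fun i j => z * M i j) (`|z| * c).
Proof.
move=> bM B b bB; rewrite -mulrA.
have -> : \sum_(i < K) \sum_(j < K) z * M i j * B i j =
          z * \sum_(i < K) \sum_(j < K) M i j * B i j.
  rewrite mulr_sumr; apply: eq_bigr => i _.
  rewrite mulr_sumr; apply: eq_bigr => j _.
  by rewrite mulrA.
by rewrite normrM ler_wpM2l // bM.
Qed.

Lemma mult_bound_sum (I : finType) (M : I -> nat -> nat -> C) (c : I -> C) :
  (forall k, mult_bound (M k) (c k)) ->
  mult_bound (fun i j => \sum_k M k i j) (\sum_k c k).
Proof.
move=> bM B b bB.
have -> : \sum_(i < K) \sum_(j < K) (\sum_k M k i j) * B i j =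
          \sum_k \sum_(i < K) \sum_(j < K) M k i j * B i j.
  rewrite [RHS]exchange_big; apply: eq_bigr => i _; rewrite [RHS]exchange_big.
  by apply: eq_bigr => j _; rewrite mulr_suml.
apply: le_trans (ler_norm_sum _ _ _) _; rewrite mulr_suml.
by apply: ler_sum => k _; apply: bM.
Qed.

Lemma mult_boundD M M' c c' : mult_bound M c -> mult_bound M' c' ->
  mult_bound (fun i j => M i j + M' i j) (c + c').
Proof.
move=> bM bM' B b bB.
have -> : \sum_(i < K) \sum_(j < K) (M i j + M' i j) * B i j =
          \sum_(i < K) \sum_(j < K) M i j * B i j +
          \sum_(i < K) \sum_(j < K) M' i j * B i j.
  rewrite -big_split; apply: eq_bigr => i _; rewrite -big_split.
  by apply: eq_bigr => j _; rewrite mulrDl.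
by apply: le_trans (ler_normD _ _) _; rewrite mulrDl lerD ?bM ?bM'.
Qed.

(** Without the phases w^(k^2) and w^(-k^2), which cancel, this would be the
    expansion of a sum over k by the Fourier transforms of x and y in k.  The
    phases make both transforms small for the x and y of interest: that of a
    character becomes a Gauss sum, instead of being concentrated at one point. *)
Lemma mult_bound_fourier n (w : C) (x y : nat -> nat -> C) (s t : C) :
  n.-primitive_root w -> 0 < s -> 0 < t ->
  (forall c i, `|\sum_(k < n) x k i * w ^+ (k ^ 2 + k * c)| <= s) ->
  (forall c j, `|\sum_(k < n) y k j * w ^- (k ^ 2 + k * c)| <= t) ->
  mult_bound (fun i j => \sum_(k < n) x k i * y k j) (s * t).
Proof.
move=> prim_w s0 t0 xs yt; have n_gt0 := prim_order_gt0 prim_w.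
have n0 : (n%:R : C) != 0 by rewrite pnatr_eq0 -lt0n.
pose f (c i : nat) := \sum_(k < n) x k i * w ^+ (k ^ 2 + k * c).
pose g (c j : nat) := \sum_(k < n) y k j * w ^- (k ^ 2 + k * c).
have -> : s * t = `|n%:R^-1| * \sum_(c < n) s * t.
  rewrite normfV normr_nat sumr_const card_ord.
  by rewrite -[in RHS](mulr_natl (s * t)) mulKf.
apply: (@eq_mult_bound (fun i j => n%:R^-1 * \sum_(c < n) f c i * g c j)); last first.
  apply: mult_boundZ; apply: mult_bound_sum => c.
  by apply: mult_bound_tensor => // i; [exact: xs | exact: yt].
move=> i j _ _; apply: (mulfI n0); rewrite mulVKf //.
transitivity (\sum_(k < n) \sum_(l < n)
   x k i * y l j * w ^+ (k ^ 2) * w ^- (l ^ 2) * \sum_(c < n) w ^+ (k * c) * w ^- (l * c)).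
  rewrite [RHS](eq_bigr (fun k : 'I_n => \sum_(c < n) \sum_(l < n)
      x k i * y l j * w ^+ (k ^ 2) * w ^- (l ^ 2) *
      (w ^+ (k * c) * w ^- (l * c)))); last first.
    move=> k _; rewrite exchange_big.
    by apply: eq_bigr => l _; rewrite mulr_sumr.
  rewrite exchange_big; apply: eq_bigr => c _; rewrite /f /g mulr_suml.
  apply: eq_bigr => k _; rewrite mulr_sumr; apply: eq_bigr => l _.
  by rewrite !exprD invfM; ring.
rewrite [RHS]mulr_sumr; apply: eq_bigr => k _.
under eq_bigr do rewrite (sum_primitive_root prim_w) !modn_small //.
rewrite (bigD1 k) //= big1 => [|l lk]; last first.
  by rewrite ifF ?mulr0 //; rewrite eq_sym val_eqE; apply/negbTE.
rewrite eqxx addr0; field.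
by rewrite expf_neq0 // (primitive_root_neq0 prim_w).
Qed.

End MultBound.

(** * The test functional *)

(** The exponent t_j around which the j-th block of the test polynomial sits. *)
Definition scale (n j : nat) : nat := (n * 8 ^ j.+1)%N.

(** t_j / 4 <= a < 2 t_j.  For distinct j these intervals are disjoint. *)
Definition near_scale (n j a : nat) : bool :=
  (scale n j <= 4 * a < scale n j.+1)%N.

Lemma scaleS n j : scale n j.+1 = (8 * scale n j)%N.
Proof. by rewrite /scale expnS mulnCA. Qed.

Lemma leq_scale n : {homo scale n : i j / (i <= j)%N}.
Proof. by move=> i j ij; rewrite leq_mul2l leq_exp2l // ltnS ij orbT. Qed.

Lemma scale_ge n j : (8 * n <= scale n j)%N.
Proof. by rewrite mulnC leq_mul2l expnS leq_pmulr ?orbT // expn_gt0. Qed.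

Lemma near_scale_inj n i j a : near_scale n i a -> near_scale n j a -> i = j.
Proof.
wlog ij : i j / (i < j)%N => [hw|].
  by case: (ltngtP i j) => // ij hi hj; [|symmetry]; apply: hw.
move=> /andP[_ hi] /andP[hj _]; have := leq_scale n ij; lia.
Qed.

(** If a + b is within 3n of t_j, then a or b is comparable to t_j. *)
Lemma near_scale_sum n j a b p q : (p < 3 * n)%N -> (q < 3 * n)%N ->
  (a + b + q = scale n j + p)%N -> near_scale n j a || near_scale n j b.
Proof. by rewrite /near_scale scaleS; have := scale_ge n j; lia. Qed.

Section TestFunctional.
Variables (C : numClosedFieldType) (n : nat) (w : C).

(** The autocorrelation of the indicator function of [0, 3n), centred at t_j:
    its value at t_j + x is the number of pairs p, q < 3n with p - q = x. *)
Definition window (j m : nat) : C :=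
  \sum_(p < 3 * n) \sum_(q < 3 * n) (m + q == scale n j + p)%N%:R.

(** The function phi whose Hankel matrix is tested against the coefficients of
    the tensor. *)
Definition test_fun (m : nat) : C := \sum_(j < n) w ^+ (j * m) * window j m.

Lemma sum_near_scale a (v : nat -> C) : (forall j, `|v j| <= 1) ->
  `|\sum_(j < n) (near_scale n j a)%:R * v j| <= 1.
Proof.
move=> v1; case: (pickP (fun j : 'I_n => near_scale n j a)) => [j ja | no].
  rewrite (bigD1 j) //= big1 => [|i ij]; first by rewrite ja mul1r addr0.
  case: (boolP (near_scale n i a)) => [ia|]; last by rewrite mul0r.
  by case/eqP: ij; apply/val_inj/(near_scale_inj ia ja).
by rewrite big1 ?normr0 ?ler01 // => i _; rewrite no mul0r.
Qed.

Section Fourier.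
Variables (Q : nat) (z : C).
Hypothesis prim_z : Q.-primitive_root z.

(** The Fourier transform, at the s-th power of z, of the indicator function of
    [0, 3n). *)
Definition dirichlet (s : nat) : C := \sum_(q < 3 * n) z ^+ (q * s).

(** The window is a combination of characters with nonnegative weights, as long
    as the arguments do not wrap around modulo Q. *)
Lemma window_fourier j m : (m + 3 * n <= Q)%N -> (scale n j + 3 * n <= Q)%N ->
  window j m = \sum_(s < Q) `|dirichlet s| ^+ 2 / Q%:R *
     (z ^+ (m * s) * z ^- (scale n j * s)).
Proof.
move=> mQ sQ; have Q_gt0 := prim_order_gt0 prim_z.
have Q0 : Q%:R != 0 :> C by rewrite pnatr_eq0 -lt0n.
have z0 := primitive_root_neq0 prim_z.
apply: (mulfI Q0); rewrite /window mulr_sumr.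
transitivity (\sum_(p < 3 * n) \sum_(q < 3 * n)
    \sum_(s < Q) z ^+ ((m + q) * s) * z ^- ((scale n j + p) * s)).
  apply: eq_bigr => p _; rewrite mulr_sumr; apply: eq_bigr => q _.
  rewrite (sum_primitive_root prim_z) !modn_small.
  - by case: eqP; rewrite ?mulr1 ?mulr0.
  - by apply: leq_trans sQ; rewrite ltn_add2l.
  - by apply: leq_trans mQ; rewrite ltn_add2l.
under eq_bigr do rewrite exchange_big; rewrite exchange_big mulr_sumr.
apply: eq_bigr => s _; rewrite [RHS]mulrA [Q%:R * _]mulrC divfK //.
rewrite normCK /dirichlet rmorph_sum /= mulrAC -mulrA mulr_suml exchange_big /=.
apply: eq_bigr => q _; rewrite mulr_sumr mulr_sumr; apply: eq_bigr => p _.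
rewrite (conj_primitive_rootX prim_z) !mulnDl !exprD invfM; ring.
Qed.

Lemma sum_dirichlet : (3 * n <= Q)%N ->
  \sum_(s < Q) `|dirichlet s| ^+ 2 / Q%:R = (3 * n)%:R.
Proof.
move=> nQ; have Q_gt0 := prim_order_gt0 prim_z.
have Q0 : Q%:R != 0 :> C by rewrite pnatr_eq0 -lt0n.
rewrite -mulr_suml; apply: (mulIf Q0); rewrite divfK //.
transitivity (\sum_(q < 3 * n) \sum_(p < 3 * n) \sum_(s < Q)
    z ^+ (q * s) * z ^- (p * s)).
  under [RHS]eq_bigr do rewrite exchange_big; rewrite [RHS]exchange_big.
  apply: eq_bigr => s _; rewrite normCK rmorph_sum mulr_suml.
  apply: eq_bigr => q _; rewrite mulr_sumr; apply: eq_bigr => p _.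
  by rewrite /= (conj_primitive_rootX prim_z).
rewrite (eq_bigr (fun=> Q%:R)) => [|q _].
  by rewrite sumr_const card_ord [RHS]mulr_natl.
have small (i : 'I_(3 * n)) : (i %% Q)%N = i.
  by rewrite modn_small // (leq_trans _ nQ).
under eq_bigr do rewrite (sum_primitive_root prim_z) !small.
rewrite (bigD1 q) //= eqxx big1 ?addr0 // => p pq.
by rewrite ifF // eq_sym val_eqE; apply/negbTE.
Qed.

End Fourier.

Lemma window_near j a b :
  window j (a + b) =
  window j (a + b) * (near_scale n j a || near_scale n j b)%:R.
Proof.
case: (boolP (_ || _)) => [_|not_near]; first by rewrite mulr1.
rewrite mulr0 /window big1 // => p _; rewrite big1 // => q _.
by case: eqP => // /near_scale_sum near; case/negP: not_near; apply: near.
Qed.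

Lemma test_fun_eq0 m : (scale n n <= m)%N -> test_fun m = 0.
Proof.
move=> mK; rewrite /test_fun big1 // => j _.
rewrite /window big1 ?mulr0 // => p _.
rewrite big1 // => q _; case: eqP => // e.
have := @leq_scale n j.+1 n (ltn_ord j); rewrite scaleS.
have := scale_ge n j; have := ltn_ord p; lia.
Qed.

Section Pairing.
Hypothesis prim_w : n.-primitive_root w.

(** At the exponents of the test polynomial, phi has the phase conjugate to that
    of the coefficient, and modulus at least n: only the j-th window
    contributes, and there 3n - x >= n. *)
Lemma test_fun_pairing j x : (j < n)%N -> (x < 2 * n)%N ->
  n%:R <= w ^- (j * x) * test_fun (scale n j + x).
Proof.
move=> jn xn; have w0 := primitive_root_neq0 prim_w.
have other (i : 'I_n) : val i != j -> window i (scale n j + x) = 0.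
  move=> ij; rewrite /window big1 // => p _; rewrite big1 // => q _.
  case: eqP => // e; have hp := ltn_ord p; have hq := ltn_ord q.
  case: (ltngtP i j) ij => // [lij|lji] _.
    by have := leq_scale n lij; rewrite scaleS; have := scale_ge n i; lia.
  by have := leq_scale n lji; rewrite scaleS; have := scale_ge n j; lia.
rewrite /test_fun (bigD1 (Ordinal jn)) //= big1 ?addr0 => [|i ij]; last first.
  by rewrite other ?mulr0.
have -> : w ^+ (j * (scale n j + x)) = w ^+ (j * x).
  by rewrite mulnDr exprD mulnCA exprM (prim_expr_order prim_w) expr1n mul1r.
rewrite mulKf ?expf_neq0 //.
rewrite /window exchange_big /=.
rewrite [X in _ <= X](_ : _ = \sum_(q < 3 * n) (x + q < 3 * n)%N%:R); last first.
  apply: eq_bigr => q _; case: ltnP => h.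
    rewrite (bigD1 (Ordinal h)) //= addnA eqxx big1 ?addr0 // => p.
    by rewrite -val_eqE /= -addnA eqn_add2l eq_sym => /negbTE ->.
  rewrite big1 // => p _; rewrite -addnA eqn_add2l gtn_eqF //.
  exact: leq_trans (ltn_ord p) h.
rewrite -(big_mkord xpredT (fun q => (x + q < 3 * n)%N%:R)).
rewrite (@big_cat_nat _ _ _ n) //=; last by rewrite leq_pmull.
apply: ler_wpDr; first by apply: sumr_ge0 => q _; exact: ler0n.
rewrite big_nat (eq_bigr (fun=> 1)) => [|q /andP[_ qn]]; last first.
  by have -> : (x + q < 3 * n)%N by lia.
by rewrite -big_nat sumr_const_nat subn0.
Qed.

End Pairing.

Section Bound.
Variable k : nat.
Hypotheses (prim_w : n.-primitive_root w) (odd_k : odd k) (nE : n = (k ^ 2)%N).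

Let n_gt0 : (0 < n)%N := prim_order_gt0 prim_w.
Let k_gt0 : (0 < k)%N. Proof. by case: (k) odd_k. Qed.

Lemma gauss_sumX c : `|\sum_(j < n) w ^+ (j ^ 2 + j * c)| = k%:R.
Proof.
apply: (@pexpIrn _ 2) => //; rewrite ?nnegrE //.
by rewrite gauss_sum_norm // nE ?oddX // natrX.
Qed.

Lemma gauss_sumV b c :
  `|\sum_(j < n) w ^+ (j * b) * w ^- (j ^ 2 + j * c)| = k%:R.
Proof.
rewrite -norm_conjC rmorph_sum /= -(gauss_sumX (c + n.-1 * b)); congr `|_|.
apply: eq_bigr => j _; rewrite rmorphM /= -(conj_primitive_rootX prim_w (_ + _)).
rewrite conjCK (conj_primitive_rootX prim_w).
have w0 := primitive_root_neq0 prim_w.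
rewrite mulrC; apply: (mulIf (x := w ^+ (j * b))); first by rewrite expf_neq0.
rewrite mulfVK ?expf_neq0 // -exprD.
have -> : (j ^ 2 + j * (c + n.-1 * b) + j * b = j ^ 2 + j * c + n * (j * b))%N.
  by rewrite -[X in (_ = _ + X * _)%N](prednK n_gt0); lia.
rewrite [w ^+ (_ + n * _)]exprD [w ^+ (n * _)]exprM.
by rewrite (prim_expr_order prim_w) expr1n mulr1.
Qed.

(** The part of the Hankel matrix of phi carried by a single character.  The two
    cases, a near t_j, and b near t_j with a not near t_j, are bounded by k and
    k + 1. *)
Lemma slice_bound Q (z : C) s K : Q.-primitive_root z ->
  mult_bound K (fun a b => \sum_(j < n)
     w ^+ (j * (a + b)) * (z ^+ ((a + b) * s) * z ^- (scale n j * s)) *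
     (near_scale n j a || near_scale n j b)%:R) ((2 * k + 1)%:R : C).
Proof.
move=> prim_z; have nw j := norm_primitive_rootX prim_w j.
have nwV j := norm_primitive_rootV prim_w j.
have nz j := norm_primitive_rootX prim_z j.
have nzV j := norm_primitive_rootV prim_z j.
have k0 : 0 < k%:R :> C by rewrite ltr0n.
have k1 : 0 < k%:R + 1 :> C by rewrite ltr_wpDr.
have -> : (2 * k + 1)%:R = 1 * k%:R + (k%:R + 1) * 1 :> C.
  by rewrite natrD natrM; ring.
(* x is supported near t_j; y is free, y' vanishes near t_j *)
pose u j a : C := z ^- (scale n j * s) * (z ^+ (a * s) * w ^+ (j * a)).
pose x j a : C := (near_scale n j a)%:R * u j a.
pose y j a : C := w ^+ (j * a) * z ^+ (a * s).
pose y' j a : C := (1 - (near_scale n j a)%:R) * y j a.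
have nu j a : `|u j a| = 1 by rewrite !normrM nzV nz nw !mulr1.
have ny j a : `|y j a| = 1 by rewrite normrM nz nw mulr1.
apply: (@eq_mult_bound _ _ (fun a b =>
    \sum_(j < n) x j a * y j b + \sum_(j < n) y' j a * x j b)).
  move=> a b _ _; rewrite -big_split; apply: eq_bigr => j _ /=.
  rewrite /x /y' /y /u mulnDr mulnDl !exprD.
  case: (near_scale n j a); case: (near_scale n j b) => /=; ring.
apply: mult_boundD; apply: (mult_bound_fourier prim_w) => //.
- move=> c a; under eq_bigr do rewrite -mulrA.
  apply: (@sum_near_scale a (fun j => u j a * w ^+ (j ^ 2 + j * c))) => j.
  by rewrite normrM nu nw mulr1.
- move=> c b; rewrite /y (eq_bigr (fun j : 'I_n => z ^+ (b * s) *
    (w ^+ (j * b) * w ^- (j ^ 2 + j * c)))); last by move=> j _; ring.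
  by rewrite -mulr_sumr normrM nz mul1r gauss_sumV.
- move=> c a; rewrite (eq_bigr (fun j : 'I_n =>
    z ^+ (a * s) * w ^+ (j ^ 2 + j * (c + a)) -
    (near_scale n j a)%:R * (y j a * w ^+ (j ^ 2 + j * c)))); last first.
    by move=> j _; rewrite /y' /y mulnDr addnA [w ^+ (_ + j * a)]exprD; ring.
  rewrite sumrB; apply: le_trans (ler_normB _ _) _; apply: lerD.
    by rewrite -mulr_sumr normrM nz mul1r gauss_sumX.
  apply: (@sum_near_scale a (fun j => y j a * w ^+ (j ^ 2 + j * c))) => j.
  by rewrite normrM ny nw mulr1.
- move=> c a; under eq_bigr do rewrite -mulrA.
  apply: (@sum_near_scale a (fun j => u j a * w ^- (j ^ 2 + j * c))) => j.
  by rewrite normrM nu nwV mulr1.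
Qed.

Lemma test_fun_bound :
  mult_bound (scale n n) (fun a b => test_fun (a + b))
    ((3 * n * (2 * k + 1))%:R : C).
Proof.
(* a + b + q < Q for all a, b < scale n n and q < 3n: no wrap-around modulo Q *)
pose Q := (4 * scale n n)%N; have K8 := scale_ge n n.
have [|z prim_z] := @primitive_root_exists C Q; first by rewrite /Q; lia.
apply: (@eq_mult_bound _ _ (fun a b => \sum_(s < Q)
   `|dirichlet z s| ^+ 2 / Q%:R * \sum_(j < n) w ^+ (j * (a + b)) *
     (z ^+ ((a + b) * s) * z ^- (scale n j * s)) *
     (near_scale n j a || near_scale n j b)%:R)).
  move=> a b aK bK; rewrite /test_fun.
  transitivity (\sum_(j < n) \sum_(s < Q) `|dirichlet z s| ^+ 2 / Q%:R *
     (w ^+ (j * (a + b)) * (z ^+ ((a + b) * s) * z ^- (scale n j * s)) *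
     (near_scale n j a || near_scale n j b)%:R)).
    by rewrite exchange_big; apply: eq_bigr => s _; rewrite mulr_sumr.
  apply: eq_bigr => j _; rewrite window_near (@window_fourier _ _ prim_z).
  - by rewrite mulr_suml mulr_sumr; apply: eq_bigr => s _; ring.
  - by rewrite /Q; lia.
  - by have := @leq_scale n j n (ltnW (ltn_ord j)); rewrite /Q; lia.
rewrite natrM -(@sum_dirichlet _ _ prim_z); last by rewrite /Q; lia.
rewrite mulr_suml; apply: mult_bound_sum => s.
have c0 : 0 <= `|dirichlet z s| ^+ 2 / Q%:R by rewrite divr_ge0 ?exprn_ge0.
have := mult_boundZ (`|dirichlet z s| ^+ 2 / Q%:R)
  (slice_bound s (K := scale n n) prim_z).
by rewrite (ger0_norm c0).
Qed.

End Bound.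
End TestFunctional.

(** * The test polynomial *)

Lemma sum_antidiagonal (V : zmodType) K (F : nat -> nat -> V) :
  (forall a b, (K <= a + b)%N -> F a b = 0) ->
  \sum_(a < K) \sum_(b < K) F a b =
  \sum_(m < K) \sum_(a < m.+1) F a (m - a)%N.
Proof.
move=> F0.
transitivity (\sum_(m < K) \sum_(a < K | (a <= m)%N) F a (m - a)%N).
  rewrite [RHS](exchange_big_dep xpredT) //=; apply: eq_bigr => a _.
  rewrite -(big_mkord xpredT (F a)) (@big_cat_nat _ _ _ (K - a)) ?leq_subr //=.
  rewrite [X in _ + X]big_nat [X in _ + X]big1 ?addr0; last first.
    by move=> b /andP[hb _]; rewrite F0 //; lia.
  rewrite -(big_mkord (fun m => a <= m)%N (fun m => F a (m - a)%N)).
  rewrite [RHS](@big_cat_nat _ _ _ a) //=; last exact: ltnW.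
  rewrite [X in _ = X + _]big_nat_cond [X in _ = X + _]big1 ?add0r; last first.
    by move=> m /andP[/andP[_ hm]]; rewrite leqNgt hm.
  have := @big_addn V 0 +%R 0 K a (fun m => a <= m)%N (fun m => F a (m - a)%N).
  rewrite add0n => ->.
  by apply: eq_big => [m|m _]; rewrite ?leq_addl // addnK.
apply: eq_bigr => m _.
by rewrite (big_ord_widen K (fun a => F a (m - a)%N) (ltn_ord m)).
Qed.

Lemma ltn_test_exponent n (j i l : 'I_n) :
  (scale n j + (i + l) < scale n n)%N.
Proof.
have := leq_scale n (ltn_ord j); rewrite scaleS; have := scale_ge n j.
by have := ltn_ord i; have := ltn_ord l; lia.
Qed.

Section TestPolynomial.
Variable C : numClosedFieldType.

(** The polynomial P = sum_j z^(t_j) (sum_i w^(-ij) z^i)^2, with the square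
    expanded. *)
Definition test_poly (n : nat) (w : C) : {poly C} :=
  \sum_(j < n) \sum_(i < n) \sum_(l < n)
     w ^- (j * (i + l)) *: 'X^(scale n j + (i + l)).

Lemma size_test_poly n w : (size (test_poly n w) <= scale n n)%N.
Proof.
apply/(leq_trans (size_sum _ _ _))/bigmax_leqP => j _.
apply/(leq_trans (size_sum _ _ _))/bigmax_leqP => i _.
apply/(leq_trans (size_sum _ _ _))/bigmax_leqP => l _.
apply: leq_trans (size_scale_leq _ _) _; rewrite size_polyXn.
exact: ltn_test_exponent.
Qed.

(** Evaluation of the test polynomial when z^m stands for y m. *)
Lemma sum_test_poly n w (V : lmodType C) (y : nat -> V) :
  \sum_(m < scale n n) (test_poly n w)`_m *: y m =
  \sum_(j < n) \sum_(i < n) \sum_(l < n)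
     w ^- (j * (i + l)) *: y (scale n j + (i + l))%N.
Proof.
rewrite /test_poly; under eq_bigr do rewrite coef_sum scaler_suml.
rewrite exchange_big; apply: eq_bigr => j _.
under eq_bigr do rewrite coef_sum scaler_suml.
rewrite exchange_big; apply: eq_bigr => i _.
under eq_bigr do rewrite coef_sum scaler_suml.
rewrite exchange_big; apply: eq_bigr => l _.
rewrite (bigD1 (Ordinal (ltn_test_exponent j i l))) //= big1 => [|m ml].
  by rewrite coefZ coefXn eqxx mulr1 addr0.
rewrite coefZ coefXn; have -> : (val m == (scale n j + (i + l)))%N = false.
  by apply/negbTE; rewrite -val_eqE in ml.
by rewrite mulr0 scale0r.
Qed.

(** The matrix B stands for the coefficients of a tensor which represents the
    test polynomial.  Pairing B with the Hankel matrix of phi gives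
    n^4 <= 3n (2k + 1) b. *)
Lemma test_poly_lower (k n : nat) (w : C) (B : nat -> nat -> C) (b : C) :
  n.-primitive_root w -> odd k -> n = (k ^ 2)%N ->
  (forall m, (test_poly n w)`_m = \sum_(i < m.+1) B i (m - i)%N) ->
  form_bound (scale n n) B b -> (k ^ 5)%:R <= 9 * b.
Proof.
move=> prim_w odd_k nE coefB bB.
have k_gt0 : (0 < k)%N by case: (k) odd_k.
have := test_fun_bound prim_w odd_k nE bB; set S := \sum_(i < _) _ => bS.
have SE : S = \sum_(m < scale n n) (test_poly n w)`_m * test_fun n w m.
  rewrite /S (@sum_antidiagonal _ _ (fun i j => test_fun n w (i + j) * B i j));
    last first.
    by move=> i j ij; rewrite test_fun_eq0 ?mul0r.
  apply: eq_bigr => m _; rewrite mulrC coefB mulr_sumr; apply: eq_bigr => i _.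
  by rewrite subnKC // -ltnS.
have pairing : (n ^ 4)%:R <= S.
  have -> : S = \sum_(j < n) \sum_(i < n) \sum_(l < n)
      w ^- (j * (i + l)) * test_fun n w (scale n j + (i + l)).
    exact: (etrans SE (sum_test_poly n w (V := C^o) _)).
  have -> : (n ^ 4)%:R = \sum_(j < n) \sum_(i < n) \sum_(l < n) n%:R :> C.
    by rewrite !sumr_const !card_ord -!mulrnA; congr _%:R; lia.
  apply: ler_sum => j _; apply: ler_sum => i _; apply: ler_sum => l _.
  apply: (test_fun_pairing prim_w) => //.
  by have := ltn_ord i; have := ltn_ord l; lia.
have b_ge0 : 0 <= b.
  by apply: le_trans (bB (fun=> 0) (fun=> 0) _ _) => // i; rewrite normr0 ler01.
have S_ge0 : 0 <= S by apply: le_trans pairing; apply: ler0n.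
rewrite (ger0_norm S_ge0) in bS; have := le_trans pairing bS.
rewrite nE => main.
have k3 : 0 < (k ^ 3)%:R :> C by rewrite ltr0n expn_gt0 k_gt0.
rewrite -(ler_pM2l k3) -natrM -expnD.
rewrite -expnM in main.
apply: le_trans main _; rewrite mulrA ler_wpM2r // -natrM ler_nat.
have : (2 * k + 1 <= 3 * k)%N by lia.
by rewrite !expnS expn0 !muln1 => h; nia.
Qed.

(** The discrete Plancherel inequality for vectors of V.  It is the only property
    of Hilbert spaces used in the upper bound. *)
Definition plancherel (V : normedModType C) : Prop :=
  forall n (w : C), n.-primitive_root w -> forall v : nat -> V,
    \sum_(i < n) `|\sum_(j < n) w ^- (i * j) *: v j| ^+ 2 <=
    n%:R * \sum_(j < n) `|v j| ^+ 2.

(** The Cauchy-Schwarz inequality against the constant 1. *)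
Lemma sqr_sum_le n (u : 'I_n -> C) : (forall i, 0 <= u i) ->
  (\sum_i u i) ^+ 2 <= n%:R * \sum_i u i ^+ 2.
Proof.
move=> u0; rewrite -subr_ge0.
have -> : n%:R * \sum_i u i ^+ 2 - (\sum_i u i) ^+ 2 =
    2^-1 * \sum_i \sum_j (u i - u j) ^+ 2.
  apply: (mulfI (x := 2)); rewrite ?pnatr_eq0 // mulVKf ?pnatr_eq0 //.
  have -> : \sum_i \sum_j (u i - u j) ^+ 2 =
     \sum_(i < n) \sum_(j < n) u i ^+ 2 + \sum_(i < n) \sum_(j < n) u j ^+ 2 -
     2 * \sum_i \sum_j u i * u j.
    rewrite -big_split mulr_sumr -sumrB; apply: eq_bigr => i _.
    rewrite -big_split mulr_sumr -sumrB; apply: eq_bigr => j _ /=; ring.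
  have -> : \sum_(i < n) \sum_(j < n) u i ^+ 2 = n%:R * \sum_i u i ^+ 2.
    rewrite mulr_sumr; apply: eq_bigr => i _.
    by rewrite sumr_const card_ord mulr_natl.
  rewrite sumr_const card_ord -[X in _ = _ + X - _]mulr_natl.
  have -> : \sum_i \sum_j u i * u j = (\sum_i u i) ^+ 2.
    by rewrite expr2 mulr_suml; apply: eq_bigr => i _; rewrite mulr_sumr.
  by ring.
rewrite mulr_ge0 ?invr_ge0 // sumr_ge0 // => i _; rewrite sumr_ge0 // => j _.
by rewrite -real_normK ?exprn_ge0 // rpredB // ger0_real.
Qed.

(** W m is the action of z^m.  The operator W 0 need not be the identity. *)
Lemma test_poly_upper (V : normedModType C) (W : nat -> {linear V -> V})
    (c : C) n (w : C) (x : V) :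
  plancherel V -> 0 <= c -> n.-primitive_root w ->
  (forall a b y, W (a + b)%N y = W a (W b y)) ->
  (forall a y, `|W a y| <= c * `|y|) ->
  `|\sum_(j < n) \sum_(i < n) \sum_(l < n)
     w ^- (j * (i + l)) *: W (scale n j + (i + l))%N x|
  <= c ^+ 3 * (n ^ 2)%:R * `|x|.
Proof.
move=> planV c0 prim_w WD Wc.
have WZ a r u : W a (r *: u) = r *: W a u by apply: linearZ.
have Wsum a (F : 'I_n -> V) : W a (\sum_l F l) = \sum_l W a (F l).
  by apply: linear_sum.
pose y j := \sum_(l < n) w ^- (j * l) *: W l x.
pose v j := W (scale n j) (y j).
have -> : \sum_(j < n) \sum_(i < n) \sum_(l < n)
     w ^- (j * (i + l)) *: W (scale n j + (i + l))%N x =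
   \sum_(i < n) W i (\sum_(j < n) w ^- (i * j) *: v j).
  rewrite exchange_big; apply: eq_bigr => i _; rewrite Wsum.
  apply: eq_bigr => j _; rewrite WZ /v /y !Wsum scaler_sumr.
  apply: eq_bigr => l _; rewrite !WZ scalerA -!WD mulnDr exprD invfM.
  by rewrite [(i * j)%N]mulnC -addnA addnCA.
have yE : \sum_(j < n) `|y j| ^+ 2 <= (n ^ 2)%:R * c ^+ 2 * `|x| ^+ 2.
  apply: le_trans (planV n w prim_w (fun l => W l x)) _.
  have -> : (n ^ 2)%:R * c ^+ 2 * `|x| ^+ 2 = n%:R * \sum_(l < n) (c * `|x|) ^+ 2.
    by rewrite sumr_const card_ord -mulr_natl natrX; ring.
  rewrite ler_wpM2l //; apply: ler_sum => l _.
  by apply: lerXn2r; rewrite ?nnegrE ?mulr_ge0.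
have vE : \sum_(j < n) `|v j| ^+ 2 <= c ^+ 2 * ((n ^ 2)%:R * c ^+ 2 * `|x| ^+ 2).
  apply: le_trans (ler_wpM2l _ yE); rewrite ?exprn_ge0 // mulr_sumr.
  apply: ler_sum => j _; rewrite -exprMn.
  by apply: lerXn2r; rewrite ?nnegrE ?mulr_ge0 // Wc.
apply: (@le_trans _ _ (\sum_(i < n) c * `|\sum_(j < n) w ^- (i * j) *: v j|)).
  by apply: le_trans (ler_norm_sum _ _ _) _; apply: ler_sum.
rewrite -(@ler_pXn2r _ 2) ?nnegrE ?mulr_ge0 ?exprn_ge0 //; last first.
  by apply: sumr_ge0 => i _; rewrite mulr_ge0.
apply: le_trans (sqr_sum_le _) _; first by move=> i; rewrite mulr_ge0.
under eq_bigr do rewrite exprMn.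
rewrite -mulr_sumr.
have -> : (c ^+ 3 * (n ^ 2)%:R * `|x|) ^+ 2 =
  n%:R * (c ^+ 2 * (n%:R * (c ^+ 2 * ((n ^ 2)%:R * c ^+ 2 * `|x| ^+ 2)))).
  by rewrite natrX; ring.
rewrite !ler_wpM2l ?exprn_ge0 //.
by apply: le_trans (planV n w prim_w v) _; rewrite ler_wpM2l.
Qed.

End TestPolynomial.

(** * The Plancherel inequality in Hilbert spaces *)

(** The Plancherel identity for a form h that can be expanded over the v j. *)
Lemma plancherel_form (C : numClosedFieldType) (V : lmodType C)
    (h : V -> V -> C) n (w : C) (v : nat -> V) :
  n.-primitive_root w ->
  (forall a : nat -> C, h (\sum_(j < n) a j *: v j) (\sum_(j < n) a j *: v j) =
     \sum_(j < n) \sum_(l < n) a j * (a l)^* * h (v j) (v l)) ->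
  \sum_(i < n) h (\sum_(j < n) w ^- (i * j) *: v j)
                 (\sum_(j < n) w ^- (i * j) *: v j) =
  n%:R * \sum_(j < n) h (v j) (v j).
Proof.
move=> prim_w hE.
have orth (j l : 'I_n) : \sum_(i < n) w ^- (i * j) * (w ^- (i * l))^* =
    if l == j then n%:R else 0.
  have := sum_primitive_root prim_w l j; rewrite !modn_small // val_eqE => <-.
  apply: eq_bigr => i _.
  rewrite -(conj_primitive_rootX prim_w (i * l)) conjCK mulrC.
  by rewrite [(i * l)%N]mulnC [(i * j)%N]mulnC.
under eq_bigr do rewrite (hE (fun j => w ^- (_ * j))).
rewrite exchange_big mulr_sumr; apply: eq_bigr => j _.
rewrite exchange_big (bigD1 j) //= [X in _ + X]big1 ?addr0 => [|l lj].
  by rewrite -mulr_suml orth eqxx.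
by rewrite -mulr_suml orth (negbTE lj) mul0r.
Qed.

Section Ell2.
Variable R : realType.

Lemma norm_normc (z : R[i]) : `|z| = (normc z)%:C%C.
Proof. by case: z. Qed.

Lemma ell2_normE (x : ell2 R) :
  (\sum_(k <oo) ((normc (lp_val x k) ^+ 2)%:E) = (rnorm x ^+ 2)%:E)%E.
Proof.
have xfin : (lpnorm 2 (lp_val x) < +oo)%E by exact: valP x.
rewrite (_ : rnorm x = fine (lpnorm 2 (lp_val x))) //.
move: xfin; rewrite lpnormE ?ler1n //.
under [X in _ -> X = _]eq_eseriesr do rewrite -powR_mulrn ?normc_ge0 //.
have : (0 <= \sum_(k <oo) ((normc (lp_val x k) `^ 2)%:E))%E.
  by apply: nneseries_ge0 => k _ _; rewrite lee_fin powR_ge0.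
case: (X in (0 <= X)%E) => [s s0 _||] //.
  by rewrite poweR_EFin powR12_sqrt // sqr_sqrtr.
by rewrite poweRyr ?invr_eq0 ?pnatr_eq0 // ltxx.
Qed.

Lemma lp_val_sum (p : R) (p1 : 1 <= p) n (a : nat -> R[i]) (v : nat -> lp p1) k :
  lp_val (\sum_(j < n) a j *: v j) k = \sum_(j < n) a j * lp_val (v j) k.
Proof.
elim: n => [|n IHn]; first by rewrite !big_ord0.
by rewrite !big_ord_recr /= -IHn.
Qed.

Lemma ell2_plancherel : plancherel (ell2 R).
Proof.
move=> n w prim_w v.
have rE (x : ell2 R) : `|x| ^+ 2 = ((rnorm x ^+ 2)%:C)%C by rewrite rmorphXn.
under eq_bigr do rewrite rE; under [X in _ <= _ * X]eq_bigr do rewrite rE.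
rewrite -!rmorph_sum -(rmorph_nat (@real_complex R)) -rmorphM lecR /=.
rewrite -lee_fin EFinM -!sumEFin.
under eq_bigr do rewrite -ell2_normE.
under [X in (_ <= _ * X)%E]eq_bigr do rewrite -ell2_normE.
rewrite -!nneseries_sum; try by move=> *; rewrite lee_fin exprn_ge0 ?normc_ge0.
rewrite -nneseriesZl; last first.
  by move=> k _; apply: sume_ge0 => j _; rewrite lee_fin exprn_ge0 ?normc_ge0.
apply: lee_nneseries => [k _ _|k _].
  by apply: sume_ge0 => j _; rewrite lee_fin exprn_ge0 ?normc_ge0.
rewrite !sumEFin -EFinM lee_fin -lecR rmorphM !rmorph_sum /= rmorph_nat.
have cE (z : R[i]) : ((normc z ^+ 2)%:C)%C = z * z^*.
  by rewrite -normCK norm_normc rmorphXn.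
under eq_bigr do rewrite cE (lp_val_sum _ (fun j => w ^- (_ * j)) v).
under [X in _ <= _ * X]eq_bigr do rewrite cE.
rewrite (@plancherel_form _ R[i]^o (fun x y => x * y^*) n w
           (fun j => lp_val (v j) k)) // => a.
rewrite rmorph_sum mulr_suml; apply: eq_bigr => j _.
rewrite mulr_sumr; apply: eq_bigr => l _.
by rewrite /= rmorphM /= /GRing.scale /=; ring.
Qed.

End Ell2.

Lemma hilbert_plancherel (R : realType) (H : hilbert R) : plancherel H.
Proof.
move=> n w prim_w v.
under eq_bigr do rewrite hdotE; under [X in _ <= _ * X]eq_bigr do rewrite hdotE.
rewrite (@plancherel_form _ _ (@hdot R H)) // => a.
rewrite linear_sumlz; apply: eq_bigr => j _.
rewrite linear_sumr; apply: eq_bigr => l _.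
by rewrite linearZl linearZr /= mulrA.
Qed.

(** * The injective norm on the tensor square of l_1 *)

Section Injective.
Variable R : realType.
Implicit Types (f g : nat -> R[i]) (x : ell1 R).

Lemma rnormE (V : normedModType R[i]) (y : V) : `|y| = ((rnorm y)%:C)%C.
Proof. by rewrite /rnorm RRe_real // ger0_real. Qed.

Lemma opnorm_le1 (V : normedModType R[i]) (F : V -> R[i]^o) :
  (forall y, `|F y| <= `|y|) -> (opnorm F <= 1)%E.
Proof.
move=> Fx; apply: ge_ereal_sup => _ [y /= y1 <-]; rewrite lee_fin.
by apply: le_trans y1; rewrite -lecR -!rnormE.
Qed.

Lemma ell1_normE x : (\sum_(k <oo) (normc (lp_val x k))%:E = (rnorm x)%:E)%E.
Proof.
have xfin : (lpnorm 1 (lp_val x) < +oo)%E by exact: valP x.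
rewrite (_ : rnorm x = fine (lpnorm 1 (lp_val x))) // fineK; last first.
  by rewrite ge0_fin_numE // Lnorm_ge0.
rewrite lpnormE // invr1 poweRe1; last first.
  by apply: nneseries_ge0 => k _ _; rewrite lee_fin powR_ge0.
by apply: eq_eseriesr => k _; rewrite powRr1 ?normc_ge0.
Qed.

Lemma ell1_sum_le K f x : (forall i, `|f i| <= 1) ->
  `|\sum_(i < K) f i * lp_val x i| <= `|x|.
Proof.
move=> f1; apply: (@le_trans _ _ (\sum_(i < K) `|lp_val x i|)).
  apply: le_trans (ler_norm_sum _ _ _) _; apply: ler_sum => i _.
  by rewrite normrM ler_piMl.
under eq_bigr do rewrite norm_normc.
rewrite rnormE -rmorph_sum lecR -lee_fin -ell1_normE -sumEFin.
rewrite -(big_mkord xpredT (fun i => (normc (lp_val x i))%:E)).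
by apply: nneseries_lim_ge => i _ _; rewrite lee_fin normc_ge0.
Qed.

Section Pairing.
Variables (K : nat) (f : nat -> R[i]) (f1 : forall i, `|f i| <= 1).

(** The functional on l_1 given by the first K terms of a sequence f of modulus
    at most 1. *)
Definition ell1_pairing_fun x : R[i]^o := \sum_(i < K) f i * lp_val x i.

Let pairing_linear : linear ell1_pairing_fun.
Proof.
move=> c x y; rewrite /ell1_pairing_fun scaler_sumr -big_split.
by apply: eq_bigr => i _ /=; rewrite /GRing.scale /= mulrDr mulrCA.
Qed.

HB.instance Definition _ := GRing.isLinear.Build R[i] (ell1 R) R[i]^o _
  ell1_pairing_fun pairing_linear.

Let pairing_continuous : continuous ell1_pairing_fun.
Proof.
apply: bounded_linear_continuous; apply/linear_boundedP.
near=> r => x; apply: (@le_trans _ _ `|x|); first exact: ell1_sum_le.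
by rewrite ler_peMl//; near: r.
Unshelve. all: by end_near. Qed.

Definition ell1_pairing : dual (ell1 R) :=
  @BoundedOp R (ell1 R) R[i]^o ell1_pairing_fun pairing_continuous.

Lemma opnorm_ell1_pairing : (opnorm ell1_pairing <= 1)%E.
Proof. by apply: opnorm_le1 => x; exact: ell1_sum_le. Qed.

End Pairing.

Lemma opnorm_ell1_coord n : (opnorm (@ell1_coord R n) <= 1)%E.
Proof.
apply: opnorm_le1 => x.
have := @ell1_sum_le n.+1 (fun i => (i == n)%:R) x; rewrite big_ord_recr big1 /=.
  by rewrite add0r eqxx mul1r; apply=> i; case: eqP; rewrite ?normr1 ?normr0.
by move=> i _; rewrite ltn_eqF ?mul0r.
Qed.

Lemma injective_norm_ge (B : dual (ell1 R) -> dual (ell1 R) -> R[i]) (b : R)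
    (phi psi : dual (ell1 R)) :
  (injective_norm B <= b%:E)%E -> (opnorm phi <= 1)%E -> (opnorm psi <= 1)%E ->
  `|B phi psi| <= (b%:C)%C.
Proof.
move=> Bb phi1 psi1; rewrite norm_normc lecR -lee_fin; apply: le_trans Bb.
by apply: ereal_sup_ubound; exists phi, psi.
Qed.

(** On the dual unit balls, elements of the injective tensor product are uniform
    limits of finite tensors, hence they respect linear combinations that stay in
    the balls. *)
Lemma injective_tensor_pairing B K f g
    (f1 : forall i, `|f i| <= 1) (g1 : forall i, `|g i| <= 1) :
  injective_tensor B ->
  B (ell1_pairing K f1) (ell1_pairing K g1) =
  \sum_(i < K) \sum_(j < K) f i * g j * B (ell1_coord i) (ell1_coord j).
Proof.
move=> tB; apply/eqP; rewrite -subr_eq0 -normr_le0.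
set X := \sum_(i < K) _.
suff small (e : R) : 0 < e ->
    `|B (ell1_pairing K f1) (ell1_pairing K g1) - X| <=
    ((e * (1 + (K * K)%:R))%:C)%C.
  rewrite norm_normc lecR; apply/ler_addgt0Pr => e e0.
  rewrite add0r -lecR -norm_normc.
  have K0 : 0 < 1 + (K * K)%:R :> R by rewrite ltr_pwDl.
  have := small (e / (1 + (K * K)%:R)); rewrite divfK ?gt_eqF //; apply.
  by rewrite divr_gt0.
move=> e0; have [u ue] := tB e e0.
have uX : finite_tensor u (ell1_pairing K f1) (ell1_pairing K g1) =
    \sum_(i < K) \sum_(j < K)
       f i * g j * finite_tensor u (ell1_coord i) (ell1_coord j).
  rewrite /finite_tensor.
  under [RHS]eq_bigr do under eq_bigr do rewrite mulr_sumr.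
  under [RHS]eq_bigr do rewrite exchange_big.
  rewrite [RHS]exchange_big; apply: eq_bigr => -[x y] _ /=.
  rewrite /ell1_pairing_fun mulr_suml; apply: eq_bigr => i _.
  rewrite mulr_sumr; apply: eq_bigr => j _.
  by rewrite /ell1_coord_fun; ring.
pose D (phi psi : dual (ell1 R)) := B phi psi - finite_tensor u phi psi.
have De (phi psi : dual (ell1 R)) :
    (opnorm phi <= 1)%E -> (opnorm psi <= 1)%E -> `|D phi psi| <= (e%:C)%C.
  by move=> h1 h2; apply: (injective_norm_ge ue).
have -> : B (ell1_pairing K f1) (ell1_pairing K g1) - X =
   D (ell1_pairing K f1) (ell1_pairing K g1) -
   \sum_(i < K) \sum_(j < K) f i * g j * D (ell1_coord i) (ell1_coord j).
  have -> : \sum_(i < K) \sum_(j < K)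
       f i * g j * D (ell1_coord i) (ell1_coord j) =
     X - finite_tensor u (ell1_pairing K f1) (ell1_pairing K g1).
    rewrite uX -sumrB; apply: eq_bigr => i _; rewrite -sumrB.
    by apply: eq_bigr => j _; rewrite -mulrBr.
  by rewrite /D; ring.
apply: le_trans (ler_normB _ _) _; rewrite rmorphM rmorphD rmorph1 mulrDr mulr1.
apply: lerD; first by apply: De; apply: opnorm_ell1_pairing.
have -> : (e%:C * ((K * K)%:R)%:C)%C = \sum_(i < K) \sum_(j < K) (e%:C)%C.
  by rewrite !sumr_const !card_ord -mulrnA rmorph_nat mulr_natr.
apply: le_trans (ler_norm_sum _ _ _) _; apply: ler_sum => i _.
apply: le_trans (ler_norm_sum _ _ _) _; apply: ler_sum => j _.
rewrite !normrM.
apply: le_trans (De _ _ (opnorm_ell1_coord i) (opnorm_ell1_coord j)).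
by rewrite ler_piMl // mulr_ile1.
Qed.

Lemma form_bound_injective K (B : dual (ell1 R) -> dual (ell1 R) -> R[i]) (b : R) :
  injective_tensor B -> (injective_norm B <= b%:E)%E ->
  form_bound K (fun i j => B (ell1_coord i) (ell1_coord j)) ((b%:C)%C : R[i]).
Proof.
move=> tB Bb f g f1 g1; rewrite -(injective_tensor_pairing K f1 g1 tB).
by apply: injective_norm_ge Bb _ _; apply: opnorm_ell1_pairing.
Qed.

Lemma Lnorm_test_poly (k n : nat) (w : R[i]) :
  n.-primitive_root w -> odd k -> n = (k ^ 2)%N ->
  (((k ^ 5)%:R / 9)%:E <= Lnorm_poly (test_poly n w))%E.
Proof.
move=> prim_w odd_k nE; apply: le_ereal_inf_tmp => _ [B [tB coefB] <-].
have main (b : R) : (injective_norm B <= b%:E)%E -> (k ^ 5)%:R / 9 <= b.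
  move=> Bb; rewrite ler_pdivrMr // mulrC -lecR (rmorph_nat (real_complex R)).
  rewrite (rmorphM (real_complex R) 9 b) (rmorph_nat (real_complex R)).
  exact: test_poly_lower prim_w odd_k nE coefB (form_bound_injective _ tB Bb).
(* a representing B of norm +oo is harmless, and -oo is not a norm *)
case E : (injective_norm B) => [b||]; last 2 first.
- by rewrite leey.
- have := main (-1); rewrite E leNye => /(_ isT).
  by rewrite leNgt (lt_le_trans (ltrN10 _)) ?divr_ge0.
- by rewrite lee_fin; apply: main; rewrite E.
Qed.

(** The unit vector e_k of l_1, as a sequence. *)
Definition ell1_basis_fun (k : nat) : nat -> R[i] := fun i => (i == k)%:R.

Lemma lpnorm_basis k : (lpnorm 1 (ell1_basis_fun k) = 1)%E.
Proof.
rewrite lpnormE // invr1 poweRe1; last first.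
  by apply: nneseries_ge0 => i _ _; rewrite lee_fin powR_ge0.
rewrite (@nneseriesD1 _ _ k) //; last by move=> i _; rewrite lee_fin powR_ge0.
rewrite eseries0 ?adde0 => [|i _ /= ik].
  by rewrite /ell1_basis_fun eqxx ComplexField.Normc.normc1 powR1.
by rewrite /ell1_basis_fun (negbTE ik) ComplexField.Normc.normc0 powR0 ?oner_eq0.
Qed.

Lemma ell1_basis_subproof k : ell1_basis_fun k \in lp_pred (lexx (1 : R)).
Proof. by rewrite unfold_in /lp_pred lpnorm_basis ltry. Qed.

Definition ell1_basis k : ell1 R := Lp (ell1_basis_subproof k).

Lemma rnorm_basis k : rnorm (ell1_basis k) = 1.
Proof.
by rewrite (_ : rnorm _ = fine (lpnorm 1 (ell1_basis_fun k))) // lpnorm_basis.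
Qed.

(** The monomial z^k is represented by the tensor e_k (x) e_0. *)
Lemma Lnorm_monomial k : (Lnorm_poly ('X^k : {poly R[i]}) <= 1)%E.
Proof.
pose B : dual (ell1 R) -> dual (ell1 R) -> R[i] :=
  finite_tensor [:: (ell1_basis k, ell1_basis 0)].
have BE phi psi : B phi psi = phi (ell1_basis k) * psi (ell1_basis 0).
  by rewrite /B /finite_tensor big_seq1.
have B1 : (injective_norm B <= 1)%E.
  apply: ge_ereal_sup => _ [phi [psi [phi1 psi1 ->]]].
  have le1 (chi : dual (ell1 R)) m : (opnorm chi <= 1)%E -> `|chi (ell1_basis m)| <= 1.
    move=> chi1; rewrite norm_normc (_ : 1 = (1%:C)%C) // lecR -lee_fin.
    apply: le_trans chi1; apply: ereal_sup_ubound.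
    exists (ell1_basis m); first by rewrite /= rnorm_basis.
    by rewrite /rnorm norm_normc.
  rewrite lee_fin -lecR -norm_normc BE normrM /=.
  by rewrite mulr_ile1 // le1.
apply: le_trans B1; apply: ereal_inf_lbound; exists B => //; split.
  move=> e e0; exists [:: (ell1_basis k, ell1_basis 0)].
  apply: ge_ereal_sup => _ [phi [psi [_ _ ->]]].
  by rewrite subrr ComplexField.Normc.normc0 lee_fin ltW.
move=> n; rewrite coefXn big_ord_recr /= big1 => [|i _].
  by rewrite BE /= /ell1_coord_fun /= /ell1_basis_fun subnn eqxx mulr1 add0r.
by rewrite BE /= /ell1_coord_fun /= /ell1_basis_fun subn_eq0 leqNgt ltn_ord mulr0.
Qed.

End Injective.

(** * Non-equivalence *)

Section Conclusion.
Variable R : realType.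

(** For n = k^2 with k odd, the bound would give a k^5 / 9 <= c^3 k^4. *)
Lemma no_test_poly_bound (a c : R) : 0 < a -> 0 <= c ->
  ~ (forall n (w : R[i]), n.-primitive_root w ->
       (a%:E * Lnorm_poly (test_poly n w) <= (c ^+ 3 * (n ^ 2)%:R)%:E)%E).
Proof.
move=> a0 c0 bound.
pose m := Num.bound (9 * c ^+ 3 / a); pose k := (2 * m + 1)%N.
have odd_k : odd k by rewrite /k; lia.
have k_gt0 : (0 < k)%N by rewrite /k; lia.
have [|w prim_w] := @primitive_root_exists R[i] (k ^ 2).
  by rewrite expn_gt0 k_gt0.
have := bound _ w prim_w.
have := Lnorm_test_poly prim_w odd_k erefl.
have a0' : (0 < a%:E)%E by rewrite lte_fin.
rewrite -(lee_pmul2l _ a0') // => low /(le_trans low).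
rewrite -EFinM lee_fin -expnM (natrX _ k 5) (natrX _ k (2 * 2)) exprSr => ineq.
have k4 : 0 < (k%:R : R) ^+ 4 by rewrite exprn_gt0 // ltr0n.
have : a * k%:R <= 9 * c ^+ 3.
  rewrite -(ler_pM2l k4).
  have : 9 * (a * (k%:R ^+ 4 * k%:R / 9)) <= 9 * (c ^+ 3 * k%:R ^+ (2 * 2)).
    by rewrite ler_pM2l.
  by congr (_ <= _); field.
have m_gt : 9 * c ^+ 3 / a < m%:R.
  by apply: archi_boundP; rewrite divr_ge0 ?mulr_ge0 ?exprn_ge0 // ltW.
apply/negP; rewrite -ltNge [a * _]mulrC -ltr_pdivrMr //; apply: lt_le_trans m_gt _.
by rewrite ler_nat /k; lia.
Qed.

Lemma opnorm_le (V W : normedModType R[i]) (F : V -> W) (c : R) :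
  (forall x, `|F x| <= (c%:C)%C * `|x|) -> 0 <= c -> (opnorm F <= c%:E)%E.
Proof.
move=> Fx c0; apply: ge_ereal_sup => _ [x /= x1 <-]; rewrite lee_fin -lecR -rnormE.
apply: le_trans (Fx x) _; rewrite rnormE -rmorphM lecR.
by rewrite ler_piMr.
Qed.

Lemma le_opnorm (V W : normedModType R[i]) (F : {linear V -> W}) (c : R) x :
  (opnorm F <= c%:E)%E -> `|F x| <= (c%:C)%C * `|x|.
Proof.
move=> Fc; have [->|x0] := eqVneq x 0; first by rewrite linear0 !normr0 mulr0.
have nx : 0 < `|x| by rewrite normr_gt0.
have : `|F (`|x|^-1 *: x)| <= (c%:C)%C.
  rewrite rnormE lecR -lee_fin; apply: le_trans Fc; apply: ereal_sup_ubound.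
  exists (`|x|^-1 *: x) => //=.
  by rewrite -lecR -rnormE normrZ normfV normr_id mulVf ?gt_eqF.
have -> : F (`|x|^-1 *: x) = `|x|^-1 *: F x by apply: linearZ.
by rewrite normrZ normfV normr_id mulrC ler_pdivrMr.
Qed.

Section Iter.
Variables (V : normedModType R[i]) (T : {linear V -> V}).

Lemma iter_linear m : linear (iter m T).
Proof.
elim: m => [|m IHm] a x y //=.
by rewrite IHm linearP.
Qed.

Definition iter_op m : {linear V -> V} :=
  HB.pack (iter m T) (GRing.isLinear.Build R[i] V V _ (iter m T) (iter_linear m)).

Lemma poly_op_test_poly n (w : R[i]) x :
  poly_op (test_poly n w) T x =
  \sum_(j < n) \sum_(i < n) \sum_(l < n)
     w ^- (j * (i + l)) *: iter_op (scale n j + (i + l)) x.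
Proof.
rewrite -(sum_test_poly n w (fun m => iter m T x)) /poly_op.
rewrite (big_ord_widen _ (fun m => (test_poly n w)`_m *: iter m T x)
           (size_test_poly n w)).
rewrite big_mkcond; apply: eq_bigr => m _; case: ltnP => // h.
by rewrite nth_default // scale0r.
Qed.

End Iter.

Lemma power_norm_test_poly (c : R) n (w : R[i]) : 1 < c -> n.-primitive_root w ->
  (power_norm c (test_poly n w) <= (c ^+ 3 * (n ^ 2)%:R)%:E)%E.
Proof.
move=> c1 prim_w; have c0 : 0 <= c by rewrite ltW // (lt_trans ltr01).
apply: ge_ereal_sup => _ [T /= Tc <-].
apply: opnorm_le => [x|]; last by rewrite mulr_ge0 ?exprn_ge0.
rewrite poly_op_test_poly rmorphM rmorphXn (rmorph_nat (real_complex R)).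
apply: test_poly_upper => //.
- exact: ell2_plancherel.
- by rewrite -[0]/((0%:C)%C) lecR.
- by move=> a b y /=; rewrite iterD.
- move=> [|a] y; first by rewrite /= ler_peMl // -[1]/((1%:C)%C) lecR ltW.
  apply: le_opnorm; apply: le_trans Tc; apply: ereal_sup_ubound.
  by exists a.+1.
Qed.

Section OperatorAlgebra.
Variables (N : {poly R[i]} -> R) (A : banach_algebra R).
Variables (j : {linear {poly R[i]} -> A}) (H : hilbert R) (f : A -> bounded_op H H).
Hypotheses (jN : is_completion N j) (fA : isometric_embedding f).

(** The orbit map of a vector x under the representation of the polynomials. *)
Definition rep_at (x : H) (P : {poly R[i]}) : H := f (j P) x.

Lemma rep_at_linear x : linear (rep_at x).
Proof. by case: fA => fl _ _ a P Q; rewrite /rep_at linearP fl. Qed.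

HB.instance Definition _ x := GRing.isLinear.Build R[i] {poly R[i]} H _
  (rep_at x) (rep_at_linear x).

Lemma opnorm_rep P : opnorm (f (j P)) = (N P)%:E.
Proof. by case: fA jN => _ _ -> [_ -> _]. Qed.

Lemma operator_algebra_norm_test_poly (c : R) n (w : R[i]) :
  n.-primitive_root w -> 0 <= c -> (forall m, N 'X^m <= c) ->
  N (test_poly n w) <= c ^+ 3 * (n ^ 2)%:R.
Proof.
move=> prim_w c0 Xc; rewrite -lee_fin -opnorm_rep.
apply: opnorm_le => [x|]; last by rewrite mulr_ge0 ?exprn_ge0.
rewrite rmorphM rmorphXn (rmorph_nat (real_complex R)).
have -> : f (j (test_poly n w)) x = \sum_(i < n) \sum_(k < n) \sum_(l < n)
    w ^- (i * (k + l)) *: bop_fun (f (j 'X^(scale n i + (k + l)))) x.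
  rewrite -/(rep_at x _) /test_poly !linear_sum; apply: eq_bigr => i _.
  rewrite linear_sum; apply: eq_bigr => k _.
  rewrite linear_sum; apply: eq_bigr => l _.
  by rewrite linearZ.
apply: (@test_poly_upper _ _ (fun m => bop_fun (f (j 'X^m)))) => //.
- exact: hilbert_plancherel.
- by rewrite -[0]/((0%:C)%C) lecR.
- case: fA jN => _ fM _ [jM _ _] a b y.
  by rewrite exprD jM fM.
- by move=> m y; apply: le_opnorm; rewrite opnorm_rep lee_fin.
Qed.

End OperatorAlgebra.

End Conclusion.

Theorem corollary2p2 (R : realType) :
  (forall c : R, 1 < c -> ~ equivalent_norms (@Lnorm_poly R) (power_norm c)) /\
  (forall N : {poly R[i]} -> R, operator_algebra_norm N ->
     ~ equivalent_norms (@Lnorm_poly R) (fun P => (N P)%:E)).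
Proof.
split=> [c c1 [a [b [a0 _ eqN]]]|N [_ [A [j [jN [H [f fA]]]]]] [a [b [a0 b0 eqN]]]].
  apply: (no_test_poly_bound a0 (ltW (lt_trans ltr01 c1))) => n w prim_w.
  have /andP[low _] := eqN (test_poly n w).
  exact: le_trans low (power_norm_test_poly c1 prim_w).
apply: (no_test_poly_bound a0 (ltW b0)) => n w prim_w.
have /andP[low _] := eqN (test_poly n w).
apply: le_trans low _; rewrite lee_fin.
apply: (operator_algebra_norm_test_poly jN fA prim_w (ltW b0)) => m.
have /andP[_ up] := eqN 'X^m; rewrite -lee_fin; apply: le_trans up _.
by rewrite -[leRHS]mule1 lee_pmul2l ?lte_fin // Lnorm_monomial.
Qed.
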